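(* Let $\Omega=\Omega(u,v)$ be a solution in $E^4$ of the Betchov-Da Rios equation $\Omega_v=\Omega_u\times\Omega_{uu}\times\Omega_{uuu}$ whose $u$-parameter curves are unit speed, with ED$^2$-frame field $\{T,E,D,N\}$ and associated functions $\kappa,\sigma,\tau$ (notation and standing assumptions as in the context). Then the Gaussian torsion of the soliton surface $S:\Omega=\Omega(u,v)$ is $$K_N=\frac{\sigma}{\kappa^3\tau}\Big(\big(-\kappa^2\sigma^2+\kappa^4+2\kappa_u^2+2\kappa\kappa_{uu}\big)\tau+\big(4\kappa_u\tau_u+\kappa\tau_{uu}\big)\kappa\Big).$$
   Context: $E^4$ is Euclidean 4-space with inner product $\langle\cdot,\cdot\rangle$, and $x\times y\times z$ is the usual alternating ternary vector product of $E^4$ (with a fixed sign convention, e.g. $\langle w,x\times y\times z\rangle=\det(w,x,y,z)$). Subscripts $u,v$ denote partial derivatives. All functions are assumed sufficiently smooth on an open domain of the $(u,v)$-plane. ED$^2$-frame field: for each $v$, the unit speed curve $u\mapsto\Omega(u,v)$ lies on an oriented hypersurface of $E^4$; $T=\Omega_u$ and $N(u,v)$ is the unit normal of the hypersurface at $\Omega(u,v)$. One is in the case where $\{N,T,\Omega_{uu}\}$ is linearly dependent; $E$ is the normalization of $\Omega_{uuu}-\langle\Omega_{uuu},N\rangle N-\langle\Omega_{uuu},T\rangle T$ (assumed nonzero), and $D=N\times T\times E$. Associated functions: $\kappa=\kappa_n=\langle T_u,N\rangle$, $\sigma=\kappa_g^2=\langle E_u,D\rangle$ (the superscript in $\kappa_g^2$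 is an index, not a power), $\tau=\tau_g^1=\langle E_u,N\rangle$. The frame satisfies $T_u=\kappa N$, $E_u=\sigma D+\tau N$, $D_u=-\sigma E$, $N_u=-\kappa T-\tau E$. Standing assumption: $\kappa$ and $\tau$ are nowhere zero. Gaussian torsion (normal curvature function): $\{E,N\}$ is the orthonormal normal frame of $S$. Let $g_{11}=\langle\Omega_u,\Omega_u\rangle$, $g_{12}=\langle\Omega_u,\Omega_v\rangle$, $g_{22}=\langle\Omega_v,\Omega_v\rangle$, and $\mathcal W=\kappa^2\tau$ (so $\mathcal W^2=g_{11}g_{22}-g_{12}^2$). Let $c_{11}^1=\langle\Omega_{uu},E\rangle$, $c_{12}^1=\langle\Omega_{uv},E\rangle$, $c_{22}^1=\langle\Omega_{vv},E\rangle$, and let $c_{ij}^2$ be the same with $N$ in place of $E$. Then $$K_N=\frac{g_{11}(c_{12}^1c_{22}^2-c_{12}^2c_{22}^1)-g_{12}(c_{11}^1c_{22}^2-c_{11}^2c_{22}^1)+g_{22}(c_{11}^1c_{12}^2-c_{11}^2c_{12}^1)}{\mathcal W^3}.$$ *)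

(* Defs.v *)
From HB Require Import structures.
From mathcomp Require Import all_boot all_order all_algebra.
From mathcomp Require Import all_classical all_reals all_analysis.

Set Implicit Arguments.
Unset Strict Implicit.
Unset Printing Implicit Defensive.

Import Order.TTheory GRing.Theory Num.Theory.
Import numFieldNormedType.Exports.

Local Open Scope classical_set_scope.
Local Open Scope ring_scope.

Section Euclidean4.
Context {R : realType}.
Implicit Types x y z w : 'rV[R]_4.

(* The library norm `|x| on 'rV[R]_4 is the sup norm: it is used only for its
   topology, and the Euclidean structure is given by dot and enorm. *)
Definition dot x y : R := \sum_(i < 4) x 0 i * y 0 i.

Definition enorm x : R := Num.sqrt (dot x x).

Definition normalize x : 'rV[R]_4 := (enorm x)^-1 *: x.

Definition det4 w x y z : R :=
  \det (\matrix_(i < 4) nth 0 [:: w; x; y; z] i).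

(* The sign convention is dot w (cross x y z) = det4 w x y z (dot_cross). *)
Definition cross x y z : 'rV[R]_4 :=
  \row_(j < 4) det4 (delta_mx 0 j) x y z.

Lemma dot_cross w x y z : dot w (cross x y z) = det4 w x y z.
Proof.
rewrite /dot [RHS](expand_det_row _ 0); apply: eq_bigr => j _.
rewrite !mxE /=; congr (_ * _).
rewrite [LHS](expand_det_row _ 0) (bigD1 j) //= big1 => [|k kj].
  rewrite !mxE /= !eqxx mul1r addr0 /cofactor; congr (_ * \det _).
  by apply/matrixP => a b; rewrite !mxE /=.
by rewrite !mxE /= (negbTE kj) mul0r.
Qed.

End Euclidean4.

Section Partials.
Context {R : realType} {V : normedModType R}.

Definition pu (F : R -> R -> V) : R -> R -> V :=
  fun u v => derive1 (fun s => F s v) u.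

Definition pv (F : R -> R -> V) : R -> R -> V :=
  fun u v => derive1 (fun t => F u t) v.

(* F is of class C^k on the open set U. *)
Fixpoint Ck (k : nat) (U : set (R * R)) (F : R -> R -> V) : Prop :=
  (forall p, U p -> {for p, continuous (fun q : R * R => F q.1 q.2)}) /\
  match k with
  | 0 => True
  | j.+1 =>
    [/\ forall u v, U (u, v) ->
          derivable (fun s => F s v) u 1 /\ derivable (fun t => F u t) v 1,
        Ck j U (pu F) & Ck j U (pv F)]
  end.

End Partials.

Section Hypersurface.
Context {R : realType}.

Definition grad (f : 'rV[R]_4 -> R) (p : 'rV[R]_4) : 'rV[R]_4 :=
  \row_(i < 4) 'D_(delta_mx 0 i) f p.

(* Near each of its points M is a regular level set {f = 0}, whose normal line
   at q is spanned by grad f q; the orientation is the choice of a continuous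
   unit normal field n along M (values of n off M are irrelevant). *)
Definition oriented_hypersurface
    (M : set 'rV[R]_4) (n : 'rV[R]_4 -> 'rV[R]_4) : Prop :=
  [/\ forall p, M p -> dot (n p) (n p) = 1,
      {within M, continuous n} &
      forall p, M p -> exists (W : set 'rV[R]_4) (f : 'rV[R]_4 -> R),
        [/\ open W /\ W p,
            forall q, W q -> [/\ differentiable f q,
              {for q, continuous (grad f)} & grad f q != 0],
            forall q, W q -> (M q <-> f q = 0) &
            forall q, W q -> M q -> exists c : R, n q = c *: grad f q]].

End Hypersurface.

Section ED2.
Context {R : realType}.
Implicit Types (U : set (R * R)) (Omega N : R -> R -> 'rV[R]_4).

Definition frameT Omega : R -> R -> 'rV[R]_4 := pu Omega.

Definition frameA Omega N u v : 'rV[R]_4 :=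
  let Ouuu := pu (pu (pu Omega)) u v in
  Ouuu - dot Ouuu (N u v) *: N u v
       - dot Ouuu (frameT Omega u v) *: frameT Omega u v.

Definition frameE Omega N u v : 'rV[R]_4 := normalize (frameA Omega N u v).

Definition frameD Omega N u v : 'rV[R]_4 :=
  cross (N u v) (frameT Omega u v) (frameE Omega N u v).

Definition ed2_kappa Omega N u v : R :=
  dot (pu (frameT Omega) u v) (N u v).

Definition ed2_sigma Omega N u v : R :=
  dot (pu (frameE Omega N) u v) (frameD Omega N u v).

Definition ed2_tau Omega N u v : R :=
  dot (pu (frameE Omega N) u v) (N u v).

Definition unit_speed U Omega : Prop :=
  forall u v, U (u, v) -> enorm (pu Omega u v) = 1.

(* The hypersurface may change with v. *)
Definition normal_along U Omega N : Prop :=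
  forall v, exists (M : set 'rV[R]_4) (n : 'rV[R]_4 -> 'rV[R]_4),
    oriented_hypersurface M n /\
    forall u, U (u, v) -> M (Omega u v) /\ N u v = n (Omega u v).

Definition ED2_frame_field U Omega N : Prop :=
  [/\ normal_along U Omega N,
      forall u v, U (u, v) ->
        ~~ free [:: N u v; frameT Omega u v; pu (pu Omega) u v],
      forall u v, U (u, v) -> frameA Omega N u v != 0 &
      forall u v, U (u, v) ->
        ed2_kappa Omega N u v != 0 /\ ed2_tau Omega N u v != 0].

Definition betchov_da_rios U Omega : Prop :=
  forall u v, U (u, v) ->
    pv Omega u v =
    cross (pu Omega u v) (pu (pu Omega) u v) (pu (pu (pu Omega)) u v).

(* Normal curvature function of the surface Omega with respect to the
   orthonormal normal frame {n1, n2}; W is the chosen square root of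
   g11 * g22 - g12 ^+ 2. *)
Definition gaussian_torsion Omega (n1 n2 : R -> R -> 'rV[R]_4)
    (W : R -> R -> R) u v : R :=
  let Ou := pu Omega u v in
  let Ov := pv Omega u v in
  let Ouu := pu (pu Omega) u v in
  let Ouv := pv (pu Omega) u v in
  let Ovv := pv (pv Omega) u v in
  let g11 := dot Ou Ou in
  let g12 := dot Ou Ov in
  let g22 := dot Ov Ov in
  let c11_1 := dot Ouu (n1 u v) in
  let c12_1 := dot Ouv (n1 u v) in
  let c22_1 := dot Ovv (n1 u v) in
  let c11_2 := dot Ouu (n2 u v) in
  let c12_2 := dot Ouv (n2 u v) in
  let c22_2 := dot Ovv (n2 u v) in
  (g11 * (c12_1 * c22_2 - c12_2 * c22_1)
   - g12 * (c11_1 * c22_2 - c11_2 * c22_1)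
   + g22 * (c11_1 * c12_2 - c11_2 * c12_1)) / W u v ^+ 3.

(* For a soliton surface Omega_v = kappa ^+ 2 * tau *: D, so the square root is
   W = kappa ^+ 2 * tau; it is negative when tau is. *)
Definition soliton_gaussian_torsion Omega N : R -> R -> R :=
  gaussian_torsion Omega (frameE Omega N) N
    (fun u v => ed2_kappa Omega N u v ^+ 2 * ed2_tau Omega N u v).

End ED2.

(* Main.v *)
(* Write X for Omega_v, D for the third frame vector and w = kappa^2 tau. The
   unnormalized E is -kappa tau E, and Omega_v = T x T_u x T_uu = w D. Hence
   c_12^1 = <X_u, E> = - w sigma, c_12^2 = 0 and g_22 = w^2. Differentiating
   <T_u, X> = 0 in v gives kappa c_22^2 = - <Omega_uuv, X> = - <X_uu, X>, by
   symmetry of mixed partials. Finally <X, X> = w^2 differentiated twice in u,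
   with |X_u|^2 = w_u^2 + w^2 sigma^2 from Parseval in the frame, yields
   <X_uu, X> = w w_uu - w^2 sigma^2; no v-derivative of the frame is needed. *)
Require Import Defs.
From mathcomp Require Import all_boot all_order all_algebra.
From mathcomp Require Import all_classical all_reals all_analysis.
From mathcomp Require Import ring lra.
Import Order.TTheory GRing.Theory Num.Theory.
Import numFieldNormedType.Exports.
Local Open Scope classical_set_scope.
Local Open Scope ring_scope.

Set Implicit Arguments.
Unset Strict Implicit.
Unset Printing Implicit Defensive.

(** * Symmetry of mixed partial derivatives *)

Section MixedPartials.
Context {R : realType}.

(** The second difference is the increment over [[a, a + h]] of [F s (b + h) - F s b]. The mean
    value theorem in [s], then in [t] for [Fu s], produces one factor [h] each. *)
Lemma mixed_increment (F Fu Fuv : R -> R -> R) (a b h : R) : 0 < h ->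
    (forall s t, s \in `[a, a + h] -> t \in `[b, b + h] ->
      is_derive s 1 (F ^~ t) (Fu s t) /\ is_derive t 1 (Fu s) (Fuv s t)) ->
  exists s t, [/\ s \in `]a, a + h[, t \in `]b, b + h[ &
    F (a + h) (b + h) - F (a + h) b - F a (b + h) + F a b = Fuv s t * h ^+ 2].
Proof.
move=> h0 dF.
have [ah bh] : a < a + h /\ b < b + h by rewrite !ltrDl.
have [Ib0 Ib1] : b \in `[b, b + h] /\ b + h \in `[b, b + h].
  by rewrite !in_itv /= !lexx (ltW bh).
have dG s : s \in `[a, a + h] ->
    is_derive s 1 (fun s => F s (b + h) - F s b) (Fu s (b + h) - Fu s b).
  by move=> Is; have [? _] := dF _ _ Is Ib1; have [? _] := dF _ _ Is Ib0;
     exact: is_deriveB.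
have [|s Is Es] := MVT ah (fun s Is => dG s (subset_itv_oo_cc Is)).
  by apply: derivable_within_continuous => s /dG [].
have dH t : t \in `[b, b + h] -> is_derive t 1 (Fu s) (Fuv s t).
  by move=> It; case: (dF s t (subset_itv_oo_cc Is) It).
have [|t It Et] := MVT bh (fun t It => dH t (subset_itv_oo_cc It)).
  by apply: derivable_within_continuous => t /dH [].
exists s, t; split=> //.
have -> : F (a + h) (b + h) - F (a + h) b - F a (b + h) + F a b =
          F (a + h) (b + h) - F (a + h) b - (F a (b + h) - F a b) by ring.
by rewrite Es Et; ring.
Qed.

(** The second difference over a square is symmetric in the two variables, so [mixed_increment] in
    both orders gives two points of that square where [Fuv] and [Fvu] take the same value.
    Continuity at [(a, b)] carries this to the corner as the square shrinks. *)
Lemma mixed_partials_eq (U : set (R * R)) (F Fu Fv Fuv Fvu : R -> R -> R)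
    (a b : R) : open U -> U (a, b) ->
    (forall s t, U (s, t) ->
      [/\ is_derive s 1 (F ^~ t) (Fu s t), is_derive t 1 (Fu s) (Fuv s t),
          is_derive t 1 (F s) (Fv s t) & is_derive s 1 (Fv ^~ t) (Fvu s t)]) ->
    {for (a, b), continuous (fun q : R * R => Fuv q.1 q.2)} ->
    {for (a, b), continuous (fun q : R * R => Fvu q.1 q.2)} ->
  Fuv a b = Fvu a b.
Proof.
move=> Uo Uab dF cuv cvu.
apply/eqP; rewrite -subr_eq0 -normr_le0; apply/ler_addgt0Pr => e e0.
rewrite add0r.
have e2 : 0 < e / 2 by rewrite divr_gt0.
have nuv : \forall q \near (a, b), `|Fuv a b - Fuv q.1 q.2| < e / 2.
  by move/cvgrPdist_lt: cuv; apply.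
have nvu : \forall q \near (a, b), `|Fvu a b - Fvu q.1 q.2| < e / 2.
  by move/cvgrPdist_lt: cvu; apply.
have : \forall q \near (a, b), [/\ U q, `|Fuv a b - Fuv q.1 q.2| < e / 2
    & `|Fvu a b - Fvu q.1 q.2| < e / 2].
  near=> q; split; [|by near: q; exact: nuv|by near: q; exact: nvu].
  by near: q; exact: open_nbhs_nbhs.
case/nbhs_ballP => r /= r0 Br.
(* Side [r / 2] keeps the closed square inside the open ball of radius [r]. *)
have h0 : 0 < r / 2 by rewrite divr_gt0.
have hr : r / 2 < r by rewrite gtr_pMr// invf_lt1 ?ltr1n.
have inB s t : s \in `[a, a + r / 2] -> t \in `[b, b + r / 2] ->
    ball (a, b) r (s, t).
  rewrite !in_itv /= => /andP[? ?] /andP[? ?].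
  by split; rewrite /ball /= distrC ger0_norm ?subr_ge0//; lra.
have [|s [t [Is It Est]]] := @mixed_increment F Fu Fuv a b _ h0.
  by move=> s t Is It; have [/dF[]] := Br _ (inB _ _ Is It).
have [|t' [s' [It' Is' Est']]] :=
    @mixed_increment (fun t s => F s t) (fun t s => Fv s t)
      (fun t s => Fvu s t) b a _ h0.
  by move=> t' s' It' Is'; have [/dF[]] := Br _ (inB _ _ Is' It').
(* Both values times [h ^+ 2] equal the same second difference. *)
have Eq : Fuv s t = Fvu s' t'.
  apply: (mulIf (lt0r_neq0 (exprn_gt0 2 h0))).
  by rewrite -Est -Est'; ring.
have [_ d1 _] := Br _ (inB _ _ (subset_itv_oo_cc Is) (subset_itv_oo_cc It)).
have [_ _ d2] := Br _ (inB _ _ (subset_itv_oo_cc Is') (subset_itv_oo_cc It')).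
rewrite [e]splitr; apply: le_trans (ler_distD (Fuv s t) _ _) _.
by rewrite lerD// ltW// Eq distrC.
Unshelve. all: by end_near. Qed.

Lemma is_derive_coord n (M : R -> 'rV[R]_n) (dM : 'rV[R]_n) (x : R) i :
  is_derive x 1 M dM -> is_derive x 1 (fun y => M y 0 i) (dM 0 i).
Proof.
case=> dMx <-; apply: DeriveDef; first by move/derivable_mxP: dMx; exact.
by rewrite derive_mx// mxE.
Qed.

Lemma is_derive_rV n (M : R -> 'rV[R]_n) (dM : 'rV[R]_n) (x : R) :
  (forall i, is_derive x 1 (fun y => M y 0 i) (dM 0 i)) -> is_derive x 1 M dM.
Proof.
move=> dMi; have dMx : derivable M x 1.
  by apply/derivable_mxP => i j; rewrite ord1; have [] := dMi j.
apply: DeriveDef => //; apply/rowP => i.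
by rewrite derive_mx// mxE; have [] := dMi i.
Qed.

Lemma derivable_derive1 (V : normedModType R) (f : R -> V) (x : R) :
  derivable f x 1 -> is_derive x 1 f (derive1 f x).
Proof. by move=> df; rewrite derive1E; exact: derivableP. Qed.

Lemma is_derive_derive1 (V : normedModType R) (f : R -> V) (x : R) (df : V) :
  is_derive x 1 f df -> derive1 f x = df.
Proof. by case=> _; rewrite derive1E. Qed.

(** The mean value theorem is a scalar statement, so symmetry is proved one coordinate at a time. *)
Lemma pv_pu n (U : set (R * R)) (F : R -> R -> 'rV[R]_n) u v :
  open U -> Ck 2 U F -> U (u, v) -> pv (pu F) u v = pu (pv F) u v.
Proof.
move=> Uo [_ [dF [_ [dFu _ [cFuv _]]] [_ [dFv [cFvu _] _]]]] Uuv.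
apply/rowP => i.
have coord G : {for (u, v), continuous (fun q : R * R => G q.1 q.2)} ->
    {for (u, v), continuous (fun q : R * R => (G q.1 q.2 : 'rV[R]_n) 0 i)}.
  move=> cG; apply: (@continuous_comp _ _ _ (fun q : R * R => G q.1 q.2)
    (fun M : 'rV[R]_n => M 0 i)) => //; exact: coord_continuous.
have Fi := @mixed_partials_eq U (fun s t => F s t 0 i)
  (fun s t => pu F s t 0 i) (fun s t => pv F s t 0 i)
  (fun s t => pv (pu F) s t 0 i) (fun s t => pu (pv F) s t 0 i) u v Uo Uuv.
apply: Fi.
- move=> s t Ust; have [d1 d2] := dF _ _ Ust.
  have [_ d3] := dFu _ _ Ust; have [d4 _] := dFv _ _ Ust.
  split; apply: is_derive_coord.
  - exact: derivable_derive1 d1.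
  - exact: derivable_derive1 d3.
  - exact: derivable_derive1 d2.
  - exact: derivable_derive1 d4.
- exact: coord (cFuv _ Uuv).
- exact: coord (cFvu _ Uuv).
Qed.

End MixedPartials.

(** * Differentiability classes and calculus in the variable u *)

Lemma CkS {R : realType} {V : normedModType R} k (U : set (R * R))
  (F : R -> R -> V) : Ck k.+1 U F -> Ck k U F.
Proof.
elim: k F => [F [cF _]|k IH F [cF [dF CFu CFv]]]; first by split.
by split=> //; split; [exact: dF|exact: IH CFu|exact: IH CFv].
Qed.

Lemma Ck_pu {R : realType} {V : normedModType R} k (U : set (R * R))
  (F : R -> R -> V) : Ck k.+1 U F -> Ck k U (pu F).
Proof. by case=> _ []. Qed.

Lemma Ck_pv {R : realType} {V : normedModType R} k (U : set (R * R))
  (F : R -> R -> V) : Ck k.+1 U F -> Ck k U (pv F).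
Proof. by case=> _ []. Qed.

Lemma Ck_derivable_pv {R : realType} {V : normedModType R} k (U : set (R * R))
  (F : R -> R -> V) u v : Ck k.+1 U F -> U (u, v) -> derivable (F u) v 1.
Proof. by case=> _ [dF _ _] /dF[]. Qed.

Section UDerivatives.
Context {R : realType} (U : set (R * R)) (U_open : open U).

Lemma near_slice u v : U (u, v) -> \forall s \near u, U (s, v).
Proof.
move=> Uuv.
have /nbhs_ballP[r r0 Br] : nbhs (u, v) U by exact: open_nbhs_nbhs.
by apply/nbhs_ballP; exists r => // s us; apply: Br; split => //; exact: ballxx.
Qed.

(** Since [U] is open, agreement on [U] is agreement near [u] along the slice, which is all that a
    u-derivative sees. *)
Lemma eq_is_derive_slice {V : normedModType R} (F G : R -> R -> V) u v dF :
  (forall s t, U (s, t) -> F s t = G s t) -> U (u, v) ->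
  is_derive u 1 (F ^~ v) dF -> is_derive u 1 (G ^~ v) dF.
Proof.
move=> FG Uuv; apply: near_eq_is_derive.
by apply: filterS (near_slice Uuv) => s /FG.
Qed.

Lemma eq_pu {V : normedModType R} (F G : R -> R -> V) u v :
  (forall s t, U (s, t) -> F s t = G s t) -> U (u, v) -> pu F u v = pu G u v.
Proof.
move=> FG Uuv; rewrite /pu !derive1E; apply: near_eq_derive.
by apply: filterS (near_slice Uuv) => s /FG.
Qed.

(** A weakening of [Ck] that counts iterated u-derivatives only. It is the regularity tracked for E,
    kappa and tau, which enter the computation through their u-derivatives alone. *)
Fixpoint Cu {V : normedModType R} (k : nat) (F : R -> R -> V) : Prop :=
  match k with
  | 0 => True
  | j.+1 => (forall u v, U (u, v) -> derivable (F ^~ v) u 1) /\ Cu j (pu F)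
  end.

Lemma Ck_Cu {V : normedModType R} k (F : R -> R -> V) : Ck k U F -> Cu k F.
Proof.
by elim: k F => //= k IH F [_ [dF CF _]]; split; [move=> u v /dF[]|exact: IH].
Qed.

Lemma eq_Cu {V : normedModType R} k (F G : R -> R -> V) :
  (forall s t, U (s, t) -> F s t = G s t) -> Cu k F -> Cu k G.
Proof.
elim: k F G => //= k IH F G FG [dF CF]; split.
  move=> u v Uuv.
  by have [] := eq_is_derive_slice FG Uuv (derivableP (dF _ _ Uuv)).
by apply: IH CF => s t; exact: eq_pu.
Qed.

Lemma CuS {V : normedModType R} k (F : R -> R -> V) : Cu k.+1 F -> Cu k F.
Proof. by elim: k F => //= k IH F [dF CF]; split=> //; exact: IH. Qed.

Lemma Cu_pu {V : normedModType R} k (F : R -> R -> V) :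
  Cu k.+1 F -> Cu k (pu F).
Proof. by case. Qed.

Lemma Cu_is_derive {V : normedModType R} k (F : R -> R -> V) u v :
  Cu k.+1 F -> U (u, v) -> is_derive u 1 (F ^~ v) (pu F u v).
Proof. by move=> [dF _] /dF; exact: derivable_derive1. Qed.

(** The induction step of the closure lemmas below: an explicit derivative of class [k] on [U] may
    replace [pu F]. *)
Lemma is_derive_Cu {V : normedModType R} k (F dF : R -> R -> V) :
  (forall u v, U (u, v) -> is_derive u 1 (F ^~ v) (dF u v)) -> Cu k dF ->
  Cu k.+1 F.
Proof.
move=> FdF CdF; split; first by move=> u v /FdF[].
by apply: eq_Cu CdF => u v /FdF/is_derive_derive1.
Qed.

Lemma CuD {V : normedModType R} k (F G : R -> R -> V) :
  Cu k F -> Cu k G -> Cu k (fun u v => F u v + G u v).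
Proof.
elim: k F G => // k IH F G CF CG.
apply: (@is_derive_Cu _ _ _ (fun u v => pu F u v + pu G u v)).
  move=> u v Uuv.
  exact: is_deriveD (Cu_is_derive CF Uuv) (Cu_is_derive CG Uuv).
exact: IH (Cu_pu CF) (Cu_pu CG).
Qed.

Lemma CuN {V : normedModType R} k (F : R -> R -> V) :
  Cu k F -> Cu k (fun u v => - F u v).
Proof.
elim: k F => // k IH F CF.
apply: (@is_derive_Cu _ _ _ (fun u v => - pu F u v)); last exact: IH (Cu_pu CF).
by move=> u v Uuv; exact: is_deriveN (Cu_is_derive CF Uuv).
Qed.

Lemma is_derive_mul (f g : R -> R) (x df dg : R) :
  is_derive x 1 f df -> is_derive x 1 g dg ->
  is_derive x 1 (fun y => f y * g y) (df * g x + f x * dg).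
Proof.
move=> fx gx; apply: is_derive_eq (is_deriveM fx gx) _.
by rewrite /GRing.scale /=; ring.
Qed.

Lemma is_derive_scale n (k : R -> R) (M : R -> 'rV[R]_n) (x dk : R) dM :
  is_derive x 1 k dk -> is_derive x 1 M dM ->
  is_derive x 1 (fun y => k y *: M y) (dk *: M x + k x *: dM).
Proof.
move=> kx Mx; apply: is_derive_rV => i; rewrite !mxE.
under eq_fun do rewrite mxE.
by apply: is_derive_mul => //; exact: is_derive_coord.
Qed.

Lemma is_derive_dot (M L : R -> 'rV[R]_4) (x : R) dM dL :
  is_derive x 1 M dM -> is_derive x 1 L dL ->
  is_derive x 1 (fun y => dot (M y) (L y)) (dot dM (L x) + dot (M x) dL).
Proof.
move=> Mx Lx; rewrite /dot -big_split /=.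
have -> : (fun y => \sum_(i < 4) M y 0 i * L y 0 i) =
          \sum_(i < 4) (fun y => M y 0 i * L y 0 i).
  by apply/funext => y; rewrite fct_sumE.
apply: is_derive_sum => i.
by apply: is_derive_mul; exact: is_derive_coord.
Qed.

Lemma is_derive_inv (f : R -> R) (x df : R) : f x != 0 ->
  is_derive x 1 f df ->
  is_derive x 1 (fun y => (f y)^-1) (- ((f x)^-1 * (f x)^-1 * df)).
Proof.
move=> fx0 [fx <-]; apply: DeriveDef; first exact: derivableV.
by rewrite deriveV// /GRing.scale /= expr2 invfM mulNr.
Qed.

Lemma Cu_mul k (f g : R -> R -> R) :
  Cu k f -> Cu k g -> Cu k (fun u v => f u v * g u v).
Proof.
elim: k f g => // k IH f g Cf Cg.
apply: (@is_derive_Cu _ _ _ (fun u v => pu f u v * g u v + f u v * pu g u v)).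
  move=> u v Uuv.
  exact: is_derive_mul (Cu_is_derive Cf Uuv) (Cu_is_derive Cg Uuv).
exact (CuD (IH _ _ (Cu_pu Cf) (CuS Cg)) (IH _ _ (CuS Cf) (Cu_pu Cg))).
Qed.

Lemma Cu_scale n k (f : R -> R -> R) (F : R -> R -> 'rV[R]_n) :
  Cu k f -> Cu k F -> Cu k (fun u v => f u v *: F u v).
Proof.
elim: k f F => // k IH f F Cf CF.
apply: (@is_derive_Cu _ _ _ (fun u v => pu f u v *: F u v + f u v *: pu F u v)).
  move=> u v Uuv.
  exact: is_derive_scale (Cu_is_derive Cf Uuv) (Cu_is_derive CF Uuv).
exact (CuD (IH _ _ (Cu_pu Cf) (CuS CF)) (IH _ _ (CuS Cf) (Cu_pu CF))).
Qed.

Lemma Cu_dot k (F G : R -> R -> 'rV[R]_4) :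
  Cu k F -> Cu k G -> Cu k (fun u v => dot (F u v) (G u v)).
Proof.
elim: k F G => // k IH F G CF CG.
apply: (@is_derive_Cu _ _ _
  (fun u v => dot (pu F u v) (G u v) + dot (F u v) (pu G u v))).
  move=> u v Uuv.
  exact: is_derive_dot (Cu_is_derive CF Uuv) (Cu_is_derive CG Uuv).
exact (CuD (IH _ _ (Cu_pu CF) (CuS CG)) (IH _ _ (CuS CF) (Cu_pu CG))).
Qed.

(** The derivative is a polynomial in [pu f] and the inverse itself, and the inverse has one order
    less by induction. The same bootstrapping serves [Cu_sqrt]. *)
Lemma Cu_inv k (f : R -> R -> R) : (forall u v, U (u, v) -> f u v != 0) ->
  Cu k f -> Cu k (fun u v => (f u v)^-1).
Proof.
move=> f0; elim: k => // k IH Cf; have Ck := IH (CuS Cf).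
apply: (@is_derive_Cu _ _ _
  (fun u v => - ((f u v)^-1 * (f u v)^-1 * pu f u v))).
  by move=> u v Uuv; apply: is_derive_inv;
    [exact: f0|exact: Cu_is_derive Cf Uuv].
have Cff := Cu_mul Ck Ck.
exact (CuN (Cu_mul Cff (Cu_pu Cf))).
Qed.

Lemma Cu_sqrt k (f : R -> R -> R) : (forall u v, U (u, v) -> 0 < f u v) ->
  Cu k f -> Cu k (fun u v => Num.sqrt (f u v)).
Proof.
move=> f0; elim: k => // k IH Cf; have Ck := IH (CuS Cf).
apply: (@is_derive_Cu _ _ _
  (fun u v => pu f u v * (2 * Num.sqrt (f u v))^-1)).
  move=> u v Uuv.
  rewrite mulrC; apply: is_derive1_comp (Cu_is_derive Cf Uuv).
  exact: is_derive1_sqrt (f0 _ _ Uuv).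
apply: Cu_mul; first exact: (Cu_pu Cf).
apply: Cu_inv.
  by move=> u v Uuv; rewrite mulf_neq0 ?pnatr_eq0// gt_eqF// sqrtr_gt0 f0.
(* The factor 2 is absorbed by reading the denominator as a sum of two equal roots. *)
apply: eq_Cu (CuD Ck Ck) => u v _; ring.
Qed.

Lemma pu_dot (F G : R -> R -> 'rV[R]_4) k l u v :
  Cu k.+1 F -> Cu l.+1 G -> U (u, v) ->
  pu (fun u v => dot (F u v) (G u v)) u v =
  dot (pu F u v) (G u v) + dot (F u v) (pu G u v).
Proof.
move=> CF CG Uuv; apply: is_derive_derive1.
by exact: is_derive_dot (Cu_is_derive CF Uuv) (Cu_is_derive CG Uuv).
Qed.

(** The product rule applied to a constant. It turns each orthonormality relation of the frame into
    a relation between derivatives; with [F = G] it makes the derivative orthogonal to [F]. *)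
Lemma pu_dot_cst (F G : R -> R -> 'rV[R]_4) (c : R) k l u v :
  Cu k.+1 F -> Cu l.+1 G ->
  (forall s t, U (s, t) -> dot (F s t) (G s t) = c) -> U (u, v) ->
  dot (pu F u v) (G u v) = - dot (F u v) (pu G u v).
Proof.
move=> CF CG FG Uuv; apply/eqP; rewrite -addr_eq0 -(pu_dot CF CG)//.
rewrite (@eq_pu _ _ (fun _ _ => c) _ _ FG)//.
by apply/eqP; apply: is_derive_derive1; exact: is_derive_cst.
Qed.

Lemma pu_mul (f g : R -> R -> R) k l u v :
  Cu k.+1 f -> Cu l.+1 g -> U (u, v) ->
  pu (fun u v => f u v * g u v) u v = pu f u v * g u v + f u v * pu g u v.
Proof.
move=> Cf Cg Uuv; apply: is_derive_derive1.
by exact: is_derive_mul (Cu_is_derive Cf Uuv) (Cu_is_derive Cg Uuv).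
Qed.

Lemma pu_scale n (f : R -> R -> R) (F : R -> R -> 'rV[R]_n) k l u v :
  Cu k.+1 f -> Cu l.+1 F -> U (u, v) ->
  pu (fun u v => f u v *: F u v) u v = pu f u v *: F u v + f u v *: pu F u v.
Proof.
move=> Cf CF Uuv; apply: is_derive_derive1.
by exact: is_derive_scale (Cu_is_derive Cf Uuv) (Cu_is_derive CF Uuv).
Qed.

End UDerivatives.

(** * Inner product, determinants and the vector product in E^4 *)

Section FrameAlgebra.
Context {R : realType}.
Implicit Types w x y z : 'rV[R]_4.

Lemma dotE x y :
  dot x y = x 0 0 * y 0 0 + x 0 1 * y 0 1 + x 0 2%:R * y 0 2%:R
            + x 0 3%:R * y 0 3%:R.
Proof.
rewrite /dot !big_ord_recl big_ord0 addr0 !addrA.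
by congr (_ * _ + _ * _ + _ * _ + _ * _); congr (_ _ _); apply/val_inj.
Qed.

Lemma dotC x y : dot x y = dot y x.
Proof. by rewrite !dotE; ring. Qed.

Lemma dotDl x y z : dot (x + y) z = dot x z + dot y z.
Proof. by rewrite !dotE !mxE; ring. Qed.

Lemma dotNl x z : dot (- x) z = - dot x z.
Proof. by rewrite !dotE !mxE; ring. Qed.

Lemma dotZl (c : R) x z : dot (c *: x) z = c * dot x z.
Proof. by rewrite !dotE !mxE; ring. Qed.

Lemma dotDr x y z : dot z (x + y) = dot z x + dot z y.
Proof. by rewrite !(dotC z) dotDl. Qed.

Lemma dotZr (c : R) x z : dot z (c *: x) = c * dot z x.
Proof. by rewrite !(dotC z) dotZl. Qed.

Lemma dot_ge0 x : 0 <= dot x x.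
Proof. by rewrite dotE -!expr2 !addr_ge0// sqr_ge0. Qed.

Lemma dot_eq0 x : (dot x x == 0) = (x == 0).
Proof.
apply/eqP/eqP => [|->]; last by rewrite dotE !mxE; ring.
move=> /eqP; rewrite /dot psumr_eq0 => [/allP x0|i _]; last first.
  by rewrite -expr2 sqr_ge0.
apply/rowP => i; have := x0 i (mem_index_enum i).
by rewrite /= mulf_eq0 orbb !mxE => /eqP.
Qed.

Lemma enorm_gt0 x : (0 < enorm x) = (x != 0).
Proof. by rewrite /enorm sqrtr_gt0 lt_neqAle dot_ge0 eq_sym dot_eq0 andbT. Qed.

Lemma enormK x : enorm x ^+ 2 = dot x x.
Proof. by rewrite sqr_sqrtr// dot_ge0. Qed.

Lemma dot_normalize x : x != 0 -> dot (normalize x) (normalize x) = 1.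
Proof.
rewrite -enorm_gt0 => x0; rewrite dotZl dotZr -enormK.
by field; rewrite gt_eqF.
Qed.

Lemma normalizeK x : x != 0 -> enorm x *: normalize x = x.
Proof.
by rewrite -enorm_gt0 => x0; rewrite scalerA mulfV ?scale1r// gt_eqF.
Qed.

(** Cofactor expansion along the first row, on families indexed by [nat] so that it unfolds by
    computation; [bump j] skips column [j]. *)
Fixpoint laplace n (a : nat -> nat -> R) : R :=
  if n is m.+1 then
    \sum_(j < n) a 0 j * ((-1) ^+ j * laplace m (fun i k => a i.+1 (bump j k)))
  else 1.

Lemma det_laplace n (a : nat -> nat -> R) :
  \det (\matrix_(i < n, j < n) a i j) = laplace n a.
Proof.
elim: n a => [|n IH] a; first by rewrite det_mx00.
rewrite [RHS]/= (expand_det_row _ 0); apply: eq_bigr => j _.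
rewrite -IH mxE /cofactor add0n; congr (_ * (_ * \det _)).
by apply/matrixP => i k; rewrite !mxE.
Qed.

Definition det3 a1 a2 a3 b1 b2 b3 c1 c2 c3 : R :=
  a1 * (b2 * c3 - b3 * c2) - a2 * (b1 * c3 - b3 * c1)
  + a3 * (b1 * c2 - b2 * c1).

Lemma det4E w x y z :
  det4 w x y z =
    w 0 0 * det3 (x 0 1) (x 0 2%:R) (x 0 3%:R) (y 0 1) (y 0 2%:R) (y 0 3%:R)
      (z 0 1) (z 0 2%:R) (z 0 3%:R)
  - w 0 1 * det3 (x 0 0) (x 0 2%:R) (x 0 3%:R) (y 0 0) (y 0 2%:R) (y 0 3%:R)
      (z 0 0) (z 0 2%:R) (z 0 3%:R)
  + w 0 2%:R * det3 (x 0 0) (x 0 1) (x 0 3%:R) (y 0 0) (y 0 1) (y 0 3%:R)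
      (z 0 0) (z 0 1) (z 0 3%:R)
  - w 0 3%:R * det3 (x 0 0) (x 0 1) (x 0 2%:R) (y 0 0) (y 0 1) (y 0 2%:R)
      (z 0 0) (z 0 1) (z 0 2%:R).
Proof.
(* Column indices in the statement are numerals of the ring ['I_4], while [laplace] counts in [nat];
   [inord] links the two. *)
have inordE k : (k < 4)%N -> inord k = k%:R :> 'I_4.
  by case: k => [|[|[|[|//]]]] _; apply/val_inj; rewrite /= inordK.
transitivity (laplace 4 (fun i j => (nth 0 [:: w; x; y; z] i) 0 (inord j))).
  rewrite -det_laplace; congr (\det _); apply/matrixP => i j.
  by rewrite !mxE inord_val.
rewrite /laplace !big_ord_recl !big_ord0 /bump /=.
rewrite !inordE//.
rewrite /det3; ring.
Qed.

Lemma dot_cross_alt x y z :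
  [/\ dot x (cross x y z) = 0, dot y (cross x y z) = 0 &
      dot z (cross x y z) = 0].
Proof. by rewrite !dot_cross !det4E /det3; split; ring. Qed.

(** By alternation the N and T terms of the third argument contribute nothing, and exchanging T and
    N gives the sign. *)
Lemma cross_frame (T N E : 'rV[R]_4) (k a b c : R) :
  cross T (k *: N) (a *: N + b *: T + c *: E) = (- (k * c)) *: cross N T E.
Proof.
by apply/rowP => j; rewrite !mxE !det4E /det3 !mxE; ring.
Qed.

(** The Gram determinant identity; it makes D a unit vector when N, T, E are orthonormal. *)
Lemma dot_cross_cross x y z :
  dot (cross x y z) (cross x y z) =
  det3 (dot x x) (dot x y) (dot x z) (dot y x) (dot y y) (dot y z)
       (dot z x) (dot z y) (dot z z).
Proof.
rewrite dot_cross det4E !mxE !det4E !mxE /= /det3 !dotE; ring.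
Qed.

(** The matrix [Q] with rows [e i] is square, so [Q *m Q^T = 1] gives [Q^T *m Q = 1], which can be
    inserted in [x *m x^T]. *)
Lemma parseval (e : 'I_4 -> 'rV[R]_4) x :
  (forall i j, dot (e i) (e j) = (i == j)%:R) ->
  dot x x = \sum_(i < 4) dot x (e i) ^+ 2.
Proof.
move=> eo; pose Q := \matrix_i e i.
have dotM y z : dot y z = (y *m z^T) 0 0.
  by rewrite mxE; apply: eq_bigr => i _; rewrite mxE.
have QQ : Q *m Q^T = 1%:M.
  apply/matrixP => i j; rewrite !mxE -eo; apply: eq_bigr => k _.
  by rewrite !mxE.
have QQ' := mulmx1C QQ.
have xx : x *m x^T = (x *m Q^T) *m (Q *m x^T).
  by rewrite mulmxA -(mulmxA x) QQ' mulmx1.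
rewrite [LHS]dotM xx mxE.
apply: eq_bigr => i _; rewrite expr2 [in RHS]/dot !mxE; congr (_ * _).
  by apply: eq_bigr => k _; rewrite !mxE.
by apply: eq_bigr => k _; rewrite !mxE mulrC.
Qed.

Lemma parseval4 (e0 e1 e2 e3 : 'rV[R]_4) x :
  dot e0 e0 = 1 -> dot e1 e1 = 1 -> dot e2 e2 = 1 -> dot e3 e3 = 1 ->
  dot e0 e1 = 0 -> dot e0 e2 = 0 -> dot e0 e3 = 0 -> dot e1 e2 = 0 ->
  dot e1 e3 = 0 -> dot e2 e3 = 0 ->
  dot x x = dot x e0 ^+ 2 + dot x e1 ^+ 2 + dot x e2 ^+ 2 + dot x e3 ^+ 2.
Proof.
move=> h00 h11 h22 h33 h01 h02 h03 h12 h13 h23.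
rewrite (@parseval (fun i => nth 0 [:: e0; e1; e2; e3] i)).
  by rewrite !big_ord_recl big_ord0 addr0 !addrA.
case=> [[|[|[|[|//]]]] ?]; case=> [[|[|[|[|//]]]] ?] //=; by rewrite // dotC.
Qed.

End FrameAlgebra.

(** * Tangents, hypersurface normals and the linear dependence condition *)

Section TangentNormal.
Context {R : realType}.

Lemma derive_grad (f : 'rV[R]_4 -> R) (c : R -> 'rV[R]_4) (s : R) :
  derivable c s 1 -> differentiable f (c s) ->
  derive1 (f \o c) s = dot (derive1 c s) (grad f (c s)).
Proof.
move=> /derivable1_diffP dc df.
rewrite derive1E'; last exact: differentiable_comp.
rewrite diff_comp//= -derive1E'// [X in 'd f _ X]row_sum_delta linear_sum.
by apply: eq_bigr => i _; rewrite linearZ /= mxE deriveE.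
Qed.

(** The local equation [f] of the hypersurface vanishes along the curve, so its derivative there,
    the product of the tangent with [grad f], is zero; and the normal is a multiple of [grad f]. *)
Lemma dot_tangent_normal (U : set (R * R)) (Omega N : R -> R -> 'rV[R]_4) u v :
  open U -> (forall s t, U (s, t) -> derivable (Omega ^~ t) s 1) ->
  normal_along U Omega N -> U (u, v) -> dot (pu Omega u v) (N u v) = 0.
Proof.
move=> Uo dO /(_ v)[M [n [[_ _ Mreg] MN]]] Uuv.
have [Mu ->] := MN _ Uuv.
have [W [f [[Wo Wu] Wf WM Wn]]] := Mreg _ Mu.
have [c ->] := Wn _ Wu Mu.
have [df _ _] := Wf _ Wu.
rewrite dotZr -(derive_grad (dO _ _ Uuv) df) derive1E.
have cO : {for u, continuous (Omega ^~ v)}.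
  by apply: differentiable_continuous; apply/derivable1_diffP; exact: dO.
have nW : \forall s \near u, W (Omega s v) by apply: cO; exact: open_nbhs_nbhs.
have f0 : \forall s \near u, (f \o (Omega ^~ v)) s = cst 0 s.
  apply: filterS2 (near_slice Uo Uuv) nW => s Us Ws /=.
  by apply/WM => //; case: (MN _ Us).
by rewrite (near_eq_derive _ f0) derive_cst mulr0.
Qed.

(** By contraposition: the remainder [r] of [A] after projection on [N] is orthogonal to [N] and
    [T]. If it is nonzero, pairing a vanishing combination with [r], [T] and [N] in turn kills all
    three coefficients. *)
Lemma dependent_third (N T A : 'rV[R]_4) :
  dot N N = 1 -> dot T T = 1 -> dot T N = 0 -> dot A T = 0 ->
  ~~ free [:: N; T; A] -> A = dot A N *: N.
Proof.
move=> NN TT TN AT; apply: contraNeq; rewrite -subr_eq0 -dot_eq0.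
set r := A - _ => r0; have rE : A = dot A N *: N + r by rewrite addrC subrK.
have rN : dot r N = 0 by rewrite dotDl dotNl dotZl NN; ring.
have rT : dot r T = 0 by rewrite dotDl dotNl dotZl (dotC N) TN AT; ring.
apply/(@freeP _ _ _ (in_tuple [:: N; T; A])) => k.
rewrite !big_ord_recl big_ord0 addr0 /= => k0.
have dot0 x : dot 0 x = 0 by rewrite -(scale0r x) dotZl mul0r.
have Ar : dot A r = dot r r by rewrite rE dotDl dotZl (dotC N) rN mulr0 add0r.
have k2 : k (lift ord0 (lift ord0 ord0)) = 0.
  have := congr1 (dot ^~ r) k0.
  rewrite !dotDl !dotZl Ar (dotC N) (dotC T) rN rT dot0 !mulr0 !add0r => /eqP.
  by rewrite mulf_eq0 (negbTE r0) orbF => /eqP.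
have k1 : k (lift ord0 ord0) = 0.
  have := congr1 (dot ^~ T) k0.
  by rewrite k2 !dotDl !dotZl (dotC N) TN TT dot0 mul0r mulr0 add0r addr0 mulr1.
have k00 : k ord0 = 0.
  have := congr1 (dot ^~ N) k0.
  by rewrite k1 k2 !scale0r !addr0 dotZl NN mulr1 dot0.
case=> [[|[|[|//]]] i3]; [rewrite -k00|rewrite -k1|rewrite -k2];
  by congr (k _); apply/val_inj.
Qed.

End TangentNormal.

(** * Frame equations and second fundamental form of the soliton surface *)

Section SolitonSurface.
Context {R : realType} (U : set (R * R)) (U_open : open U).
(* A is the vector normalized by E, and X stands for Omega_v. *)
Context (T N A E D X : R -> R -> 'rV[R]_4) (kappa sigma tau : R -> R -> R).
Context (CT : Cu U 4 T) (CN : Cu U 3 N) (CX : Cu U 2 X).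
Context (dot_TT : forall u v, U (u, v) -> dot (T u v) (T u v) = 1)
  (dot_NN : forall u v, U (u, v) -> dot (N u v) (N u v) = 1)
  (dot_TN : forall u v, U (u, v) -> dot (T u v) (N u v) = 0)
  (dependent : forall u v, U (u, v) -> ~~ free [:: N u v; T u v; pu T u v])
  (A_def : forall u v, A u v = pu (pu T) u v
     - dot (pu (pu T) u v) (N u v) *: N u v
     - dot (pu (pu T) u v) (T u v) *: T u v)
  (E_def : forall u v, E u v = normalize (A u v))
  (D_def : forall u v, D u v = cross (N u v) (T u v) (E u v))
  (kappa_def : forall u v, kappa u v = dot (pu T u v) (N u v))
  (sigma_def : forall u v, sigma u v = dot (pu E u v) (D u v))
  (tau_def : forall u v, tau u v = dot (pu E u v) (N u v))
  (A_neq0 : forall u v, U (u, v) -> A u v != 0)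
  (kappa_neq0 : forall u v, U (u, v) -> kappa u v != 0)
  (tau_neq0 : forall u v, U (u, v) -> tau u v != 0)
  (X_def : forall u v, U (u, v) ->
     X u v = cross (T u v) (pu T u v) (pu (pu T) u v)).

Let CTu : Cu U 3 (pu T). Proof. by have [] := CT. Qed.

(** As T has constant length, T_u is orthogonal to T, so linear dependence leaves only the direction
    of N. *)
Lemma pu_T u v : U (u, v) -> pu T u v = kappa u v *: N u v.
Proof.
move=> Uuv; rewrite kappa_def; apply: dependent_third (dependent Uuv).
- exact: dot_NN.
- exact: dot_TT.
- exact: dot_TN.
by have := pu_dot_cst U_open CT CT dot_TT Uuv; rewrite [in RHS]dotC; lra.
Qed.

Lemma dot_Nu_N u v : U (u, v) -> dot (pu N u v) (N u v) = 0.
Proof.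
move=> Uuv; have := pu_dot_cst U_open CN CN dot_NN Uuv.
by rewrite [in RHS]dotC; lra.
Qed.

Lemma dot_Nu_T u v : U (u, v) -> dot (pu N u v) (T u v) = - kappa u v.
Proof.
move=> Uuv; have := pu_dot_cst U_open CT CN dot_TN Uuv.
by rewrite pu_T// dotZl dot_NN// mulr1 dotC => ->; rewrite opprK.
Qed.

Let Ckappa : Cu U 3 kappa. Proof.
apply: (@eq_Cu _ _ U_open _ _ (fun u v => dot (pu T u v) (N u v))).
  by move=> u v _; rewrite kappa_def.
exact: Cu_dot CTu CN.
Qed.

Lemma pu_pu_T u v : U (u, v) ->
  pu (pu T) u v = pu kappa u v *: N u v + kappa u v *: pu N u v.
Proof.
move=> Uuv; rewrite (eq_pu U_open pu_T Uuv); exact: pu_scale Ckappa CN Uuv.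
Qed.

(** By [pu_pu_T] the components of T_uu along N and T are kappa_u and -kappa^2. Read backwards, this
    expresses N_u through A and T. *)
Lemma frameAE u v : U (u, v) ->
  A u v = kappa u v *: pu N u v + kappa u v ^+ 2 *: T u v.
Proof.
move=> Uuv; rewrite A_def pu_pu_T// !dotDl !dotZl.
rewrite dot_NN// dot_Nu_N// (dotC (N u v)) dot_TN// dot_Nu_T//.
by apply/rowP => i; rewrite !mxE; ring.
Qed.

Lemma dot_AN u v : U (u, v) -> dot (A u v) (N u v) = 0.
Proof.
by move=> Uuv; rewrite frameAE// dotDl !dotZl dot_Nu_N// dot_TN//; ring.
Qed.

Lemma dot_AT u v : U (u, v) -> dot (A u v) (T u v) = 0.
Proof.
by move=> Uuv; rewrite frameAE// dotDl !dotZl dot_Nu_T// dot_TT//; ring.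
Qed.

Lemma dot_EE u v : U (u, v) -> dot (E u v) (E u v) = 1.
Proof. by move=> /A_neq0; rewrite E_def; exact: dot_normalize. Qed.

Lemma dot_EN u v : U (u, v) -> dot (E u v) (N u v) = 0.
Proof. by move=> Uuv; rewrite E_def dotZl dot_AN// mulr0. Qed.

Lemma dot_ET u v : U (u, v) -> dot (E u v) (T u v) = 0.
Proof. by move=> Uuv; rewrite E_def dotZl dot_AT// mulr0. Qed.

Let CA : Cu U 2 A.
Proof.
have CTuu : Cu U 2 (pu (pu T)) by have [] := CTu.
have CN2 : Cu U 2 N by exact: CuS CN.
have CT2 : Cu U 2 T by exact: CuS (CuS CT).
apply: (@eq_Cu _ _ U_open _ _ (fun u v => pu (pu T) u v
  + - (dot (pu (pu T) u v) (N u v) *: N u v)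
  + - (dot (pu (pu T) u v) (T u v) *: T u v))).
  by move=> u v _; rewrite A_def.
have CTN := Cu_dot U_open CTuu CN2; have CTT := Cu_dot U_open CTuu CT2.
have CN' := CuN U_open (Cu_scale U_open CTN CN2).
have CT' := CuN U_open (Cu_scale U_open CTT CT2).
have C1 := CuD U_open CTuu CN'.
exact (CuD U_open C1 CT').
Qed.

Let CnormA : Cu U 2 (fun u v => enorm (A u v)).
Proof.
apply: Cu_sqrt => //; last exact: Cu_dot CA CA.
by move=> u v /A_neq0 A0; rewrite lt_neqAle dot_ge0 eq_sym dot_eq0 A0.
Qed.

Let CE : Cu U 2 E.
Proof.
apply: (@eq_Cu _ _ U_open _ _ (fun u v => (enorm (A u v))^-1 *: A u v)).
  by move=> u v _; rewrite E_def.
apply: (Cu_scale U_open _ CA); apply: (Cu_inv U_open _ CnormA).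
by move=> u v /A_neq0; rewrite -enorm_gt0 => /lt0r_neq0.
Qed.

(** Here tau = <E_u, N> = -<E, N_u>, while [frameAE] gives kappa <E, N_u> = <E, A> = |A|. In
    particular kappa and tau have opposite signs. *)
Lemma kappa_tau u v : U (u, v) -> kappa u v * tau u v = - enorm (A u v).
Proof.
move=> Uuv; rewrite tau_def (pu_dot_cst U_open CE CN dot_EN Uuv).
have : dot (E u v) (A u v) = enorm (A u v).
  by rewrite -[in LHS](normalizeK (A_neq0 Uuv)) -E_def dotZr dot_EE// mulr1.
rewrite frameAE// dotDr !dotZr dot_ET// => <-; ring.
Qed.

(** Through E_u the definition of tau yields only class 1; the formula tau = -|A| / kappa recovers
    the order that tau_uu requires. *)
Let Ctau : Cu U 2 tau.
Proof.
apply: (@eq_Cu _ _ U_open _ _ (fun u v => - (enorm (A u v) * (kappa u v)^-1))).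
  by move=> u v Uuv;
    rewrite -mulNr -kappa_tau// mulrAC mulfV ?mul1r ?kappa_neq0.
have Ci := Cu_inv U_open kappa_neq0 (CuS Ckappa).
have Cm := Cu_mul U_open CnormA Ci.
exact (CuN U_open Cm).
Qed.

Lemma pu_pu_T_frame u v : U (u, v) ->
  pu (pu T) u v = pu kappa u v *: N u v + (- kappa u v ^+ 2) *: T u v
    + (- (kappa u v * tau u v)) *: E u v.
Proof.
move=> Uuv; rewrite kappa_tau// opprK E_def normalizeK ?A_neq0//.
rewrite frameAE// pu_pu_T// scaleNr; apply/rowP => i; rewrite !mxE; ring.
Qed.

Lemma dot_frameD u v : U (u, v) ->
  [/\ dot (N u v) (D u v) = 0, dot (T u v) (D u v) = 0,
      dot (E u v) (D u v) = 0 & dot (D u v) (D u v) = 1].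
Proof.
move=> Uuv; rewrite D_def.
have [ND TD ED] := dot_cross_alt (N u v) (T u v) (E u v).
split=> //; rewrite dot_cross_cross /det3 dot_NN// dot_TT// dot_EE//.
by rewrite (dotC (N u v)) dot_TN// !dot_EN// (dotC _ (E u v)) dot_ET//; ring.
Qed.

(** The signed area element, written with products so that the product rule applies directly. *)
Let w u v := kappa u v * kappa u v * tau u v.

Let w_neq0 u v : U (u, v) -> w u v != 0.
Proof. by move=> Uuv; rewrite !mulf_neq0 ?kappa_neq0 ?tau_neq0. Qed.

Let Cw : Cu U 2 w.
Proof.
have Ck := CuS Ckappa.
exact (Cu_mul U_open (Cu_mul U_open Ck Ck) Ctau).
Qed.

Let pu_wE u v : U (u, v) ->
  pu w u v = (pu kappa u v * kappa u v + kappa u v * pu kappa u v) * tau u v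
    + kappa u v * kappa u v * pu tau u v.
Proof.
move=> Uuv; apply: is_derive_derive1; have dk := Cu_is_derive Ckappa Uuv.
exact: is_derive_mul (is_derive_mul dk dk) (Cu_is_derive Ctau Uuv).
Qed.

Let pu_pu_wE u v : U (u, v) ->
  pu (pu w) u v =
  (2 * pu kappa u v ^+ 2 + 2 * kappa u v * pu (pu kappa) u v) * tau u v
  + 4 * kappa u v * pu kappa u v * pu tau u v
  + kappa u v ^+ 2 * pu (pu tau) u v.
Proof.
move=> Uuv; rewrite (eq_pu U_open pu_wE Uuv).
have dk := Cu_is_derive Ckappa Uuv; have dt := Cu_is_derive Ctau Uuv.
have dk' := Cu_is_derive (Cu_pu Ckappa) Uuv.
have dt' := Cu_is_derive (Cu_pu Ctau) Uuv.
rewrite [LHS](is_derive_derive1 (is_deriveD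
  (is_derive_mul (is_deriveD (is_derive_mul dk' dk) (is_derive_mul dk dk')) dt)
  (is_derive_mul (is_derive_mul dk dk) dt'))).
rewrite addrfctE /=.
move: (pu (pu kappa) u v) (pu (pu tau) u v) (pu kappa u v) (pu tau u v).
by move: (kappa u v) (tau u v) => *; ring.
Qed.

(** [cross_frame] with [k = kappa] and E-coefficient [c = - (kappa * tau)]. *)
Lemma X_wD u v : U (u, v) -> X u v = w u v *: D u v.
Proof.
move=> Uuv; rewrite X_def// pu_pu_T_frame// pu_T// cross_frame D_def /w.
by congr (_ *: _); ring.
Qed.

Lemma dot_X u v : U (u, v) ->
  [/\ dot (X u v) (T u v) = 0, dot (X u v) (N u v) = 0,
      dot (X u v) (E u v) = 0 & dot (X u v) (X u v) = w u v * w u v].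
Proof.
move=> Uuv; have [ND TD ED DD] := dot_frameD Uuv.
by rewrite X_wD// !dotZl dotZr !(dotC (D u v)) ND TD ED DD; split; ring.
Qed.

Lemma dot_puX_X u v : U (u, v) -> dot (pu X u v) (X u v) = w u v * pu w u v.
Proof.
move=> Uuv; have XX s t : U (s, t) -> dot (X s t) (X s t) = w s t * w s t.
  by case/dot_X.
have := eq_pu U_open XX Uuv.
by rewrite (pu_dot CX CX Uuv) (pu_mul Cw Cw Uuv) [in X in _ + X]dotC; lra.
Qed.

Lemma dot_puX_T u v : U (u, v) -> dot (pu X u v) (T u v) = 0.
Proof.
move=> Uuv; have XT s t : U (s, t) -> dot (X s t) (T s t) = 0.
  by case/dot_X.
rewrite (pu_dot_cst U_open CX CT XT Uuv) pu_T// dotZr.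
by have [_ -> _ _] := dot_X Uuv; ring.
Qed.

(** It equals -<X, N_u>, and kappa N_u is a combination of A and T, both orthogonal to X since A is
    a multiple of E. *)
Lemma dot_puX_N u v : U (u, v) -> dot (pu X u v) (N u v) = 0.
Proof.
move=> Uuv; have XN s t : U (s, t) -> dot (X s t) (N s t) = 0.
  by case/dot_X.
have [XT _ XE _] := dot_X Uuv.
rewrite (pu_dot_cst U_open CX CN XN Uuv).
have : dot (X u v) (A u v) = 0.
  by rewrite -(normalizeK (A_neq0 Uuv)) -E_def dotZr XE mulr0.
rewrite frameAE// dotDr !dotZr XT mulr0 addr0 => /eqP.
by rewrite mulf_eq0 (negbTE (kappa_neq0 Uuv)) => /eqP->; rewrite oppr0.
Qed.

Lemma dot_puX_E u v : U (u, v) ->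
  dot (pu X u v) (E u v) = - (w u v * sigma u v).
Proof.
move=> Uuv; have XE s t : U (s, t) -> dot (X s t) (E s t) = 0.
  by case/dot_X.
by rewrite (pu_dot_cst U_open CX CE XE Uuv) X_wD// dotZl sigma_def dotC.
Qed.

Lemma dot_puX_puX u v : U (u, v) ->
  dot (pu X u v) (pu X u v) = (w u v * sigma u v) ^+ 2 + pu w u v ^+ 2.
Proof.
move=> Uuv; have [ND TD ED DD] := dot_frameD Uuv.
(* The D-component comes from <X_u, X> = w w_u divided by w, so D itself is never differentiated. *)
have XD : dot (pu X u v) (D u v) = pu w u v.
  apply: (mulfI (w_neq0 Uuv)); rewrite -dot_puX_X//.
  by rewrite [in RHS]X_wD// dotZr.
rewrite (@parseval4 _ (T u v) (N u v) (E u v) (D u v));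
  rewrite ?dot_TT ?dot_NN ?dot_EE ?dot_TN ?(dotC (T u v) (E u v)) ?dot_ET
    ?(dotC (N u v) (E u v)) ?dot_EN//.
by rewrite dot_puX_T// dot_puX_N// dot_puX_E// XD; ring.
Qed.

Lemma dot_puuX_X u v : U (u, v) ->
  dot (pu (pu X) u v) (X u v) =
  w u v * pu (pu w) u v - (w u v * sigma u v) ^+ 2.
Proof.
move=> Uuv; have := eq_pu U_open dot_puX_X Uuv.
by rewrite (pu_dot (Cu_pu CX) CX Uuv)
  (pu_mul Cw (Cu_pu Cw) Uuv) dot_puX_puX//; lra.
Qed.

(** [Xv] stands for Omega_vv, constrained only through its product with T_u = kappa N. Its
    E-component cancels, being multiplied by c_12^2 = 0 and by g_12 = 0. *)
Lemma soliton_torsion u v (Xv : 'rV[R]_4) : U (u, v) ->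
    dot (pu T u v) Xv = - dot (pu (pu X) u v) (X u v) ->
  (dot (T u v) (T u v) *
     (dot (pu X u v) (E u v) * dot Xv (N u v)
      - dot (pu X u v) (N u v) * dot Xv (E u v))
   - dot (T u v) (X u v) *
     (dot (pu T u v) (E u v) * dot Xv (N u v)
      - dot (pu T u v) (N u v) * dot Xv (E u v))
   + dot (X u v) (X u v) *
     (dot (pu T u v) (E u v) * dot (pu X u v) (N u v)
      - dot (pu T u v) (N u v) * dot (pu X u v) (E u v)))
    / (kappa u v ^+ 2 * tau u v) ^+ 3 =
  sigma u v / (kappa u v ^+ 3 * tau u v) *
    ((- (kappa u v ^+ 2 * sigma u v ^+ 2) + kappa u v ^+ 4
      + 2 * pu kappa u v ^+ 2 + 2 * kappa u v * pu (pu kappa) u v) * tau u v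
     + (4 * pu kappa u v * pu tau u v + kappa u v * pu (pu tau) u v)
       * kappa u v).
Proof.
move=> Uuv.
rewrite dot_puuX_X// pu_pu_wE// pu_T// dotZl (dotC (N u v) Xv) => XvN.
have [XT XN XE XX] := dot_X Uuv.
rewrite dot_TT// (dotC (T u v)) XT !dotZl (dotC (N u v) (E u v)).
rewrite dot_EN// dot_NN//.
rewrite dot_puX_E// dot_puX_N// XX.
(* The hypothesis determines kappa <Xv, N>, so this product is made to appear. *)
have -> : dot Xv (N u v) = (kappa u v)^-1 * (kappa u v * dot Xv (N u v)).
  by rewrite mulKf// kappa_neq0.
rewrite XvN /w; move: (kappa_neq0 Uuv) (tau_neq0 Uuv).
move: (pu (pu kappa) u v) (pu (pu tau) u v) (pu kappa u v) (pu tau u v).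
move: (kappa u v) (tau u v) (sigma u v) (dot Xv (E u v)) => k t s x *.
by field; apply/andP.
Qed.

End SolitonSurface.

(** * The single v-differentiation and the conclusion *)

Lemma pv_dot0 {R : realType} (U : set (R * R)) (F G : R -> R -> 'rV[R]_4) u v :
  open U -> (forall s t, U (s, t) -> dot (F s t) (G s t) = 0) ->
  U (u, v) -> derivable (F u) v 1 -> derivable (G u) v 1 ->
  dot (F u v) (pv G u v) = - dot (pv F u v) (G u v).
Proof.
move=> Uo FG0 Uuv dF dG; apply/eqP; rewrite -addr_eq0 addrC; apply/eqP.
have dFG := is_derive_dot (derivable_derive1 dF) (derivable_derive1 dG).
rewrite -(is_derive_derive1 dFG) derive1E.
have FG : \forall t \near v, dot (F u t) (G u t) = cst 0 t.
  have /nbhs_ballP[r r0 Br] : nbhs (u, v) U by exact: open_nbhs_nbhs.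
  apply/nbhs_ballP; exists r => // t vt; apply: FG0; apply: Br.
  by split => //; exact: ballxx.
by rewrite (near_eq_derive _ FG) derive_cst.
Qed.

Theorem theorem7 (R : realType) (U : set (R * R)) (Omega N : R -> R -> 'rV[R]_4)
    (U_open : open U)
    (Omega_smooth : Ck 5 U Omega)
    (N_smooth : Ck 3 U N)
    (Omega_unit_speed : unit_speed U Omega)
    (frame : ED2_frame_field U Omega N)
    (soliton : betchov_da_rios U Omega) :
  let kappa := ed2_kappa Omega N in
  let sigma := ed2_sigma Omega N in
  let tau := ed2_tau Omega N in
  forall u v : R, U (u, v) ->
    soliton_gaussian_torsion Omega N u v =
    sigma u v / (kappa u v ^+ 3 * tau u v) *
    ((- (kappa u v ^+ 2 * sigma u v ^+ 2) + kappa u v ^+ 4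
      + 2 * pu kappa u v ^+ 2 + 2 * kappa u v * pu (pu kappa) u v) * tau u v
     + (4 * pu kappa u v * pu tau u v + kappa u v * pu (pu tau) u v)
       * kappa u v).
Proof.
move=> kappa sigma tau u v Uuv.
have kT := Ck_pu Omega_smooth; have kX := Ck_pv Omega_smooth.
have CO := Ck_Cu Omega_smooth; have CT := Ck_Cu kT; have CX := Ck_Cu kX.
have TT s t : U (s, t) -> dot (pu Omega s t) (pu Omega s t) = 1.
  by move=> /Omega_unit_speed Ts; rewrite -enormK Ts expr1n.
have [normal dependent A_neq0 kt_neq0] := frame.
have TN s t : U (s, t) -> dot (pu Omega s t) (N s t) = 0.
  by apply: dot_tangent_normal => //; case: CO.
have NN s t : U (s, t) -> dot (N s t) (N s t) = 1.
  have [M [n [[nn _ _] MN]]] := normal t.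
  by move=> /MN[Ms ->]; exact: nn.
have k2O := CkS (CkS (CkS Omega_smooth)); have k2T := CkS (CkS kT).
have Ouv s t : U (s, t) -> pv (pu Omega) s t = pu (pv Omega) s t.
  exact: pv_pu U_open k2O.
(* The v-derivative moves inwards twice: first past the outer u-derivative, by symmetry for Omega_u,
   then past the inner one, by symmetry for Omega on all of [U]. *)
have Ouuv : pv (pu (pu Omega)) u v = pu (pu (pv Omega)) u v.
  transitivity (pu (pv (pu Omega)) u v); first exact: pv_pu U_open k2T Uuv.
  exact (@eq_pu _ _ U_open _ (pv (pu Omega)) (pu (pv Omega)) u v Ouv Uuv).
(* Omega_uu is one of the factors of the vector product that defines Omega_v. *)
have Tu_X s t : U (s, t) -> dot (pu (pu Omega) s t) (pv Omega s t) = 0.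
  by move=> Ust; rewrite (soliton _ _ Ust); have [] := dot_cross_alt
    (pu Omega s t) (pu (pu Omega) s t) (pu (pu (pu Omega)) s t).
have Tu_Xv : dot (pu (pu Omega) u v) (pv (pv Omega) u v) =
             - dot (pu (pu (pv Omega)) u v) (pv Omega u v).
  rewrite -Ouuv; apply: (pv_dot0 U_open Tu_X Uuv).
    exact: Ck_derivable_pv (Ck_pu kT) Uuv.
  exact: Ck_derivable_pv kX Uuv.
(* Reading Omega_uv as (Omega_v)_u leaves Omega_vv as the only second-order term not given by
   u-derivatives of T and X. *)
rewrite /soliton_gaussian_torsion /gaussian_torsion (Ouv _ _ Uuv).
have k_neq0 s t (Ust : U (s, t)) := (kt_neq0 s t Ust).1.
have t_neq0 s t (Ust : U (s, t)) := (kt_neq0 s t Ust).2.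
exact (@soliton_torsion R U U_open (pu Omega) N (frameA Omega N)
  (frameE Omega N) (frameD Omega N) (pv Omega) kappa sigma tau
  CT (Ck_Cu N_smooth) (CuS (CuS CX)) TT NN TN dependent
  (fun _ _ => erefl) (fun _ _ => erefl) (fun _ _ => erefl)
  (fun _ _ => erefl) (fun _ _ => erefl) (fun _ _ => erefl)
  A_neq0 k_neq0 t_neq0 soliton u v (pv (pv Omega) u v) Uuv Tu_Xv).
Qed.
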